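(* Let $m\ge 1$, let $H$ be a finite group with $(m,|H|)=1$, let $\alpha\colon H\to \operatorname{Aut}(C_m)=(\mathbb{Z}/m\mathbb{Z})^\times$ be a homomorphism, and let $G=C_m\rtimes_\alpha H$. For $d\mid |G|$, write uniquely $d=d_1d_2$ with $d_1\mid m$ and $d_2\mid |H|$. Then the number $a_{d}(G)$ of elements of order $d$ in $G$ is \[a_{d_1d_2}(G)=\varphi(d_1)\sum_{\substack{h\in H\\ \operatorname{ord}(h)=d_2}}(m,S_h)\left[d_1\mid \frac{m}{(m,S_h)}\right],\] where $S_h:=\sum_{t=0}^{\operatorname{ord}(h)-1}\alpha(h)^t \pmod m$ and $[\cdot]$ denotes the indicator function ($1$ if the condition holds and $0$ otherwise).
   Context: $C_m$ is the cyclic group of order $m$, identified with $\mathbb{Z}/m\mathbb{Z}$; elements of $G=C_m\rtimes_\alpha H$ are written $(i,h)$ with multiplication $(i,h_1)(j,h_2)=(i+\alpha(h_1)j,h_1h_2)$. $(x,y)$ applied to integers (or residues mod $m$) denotes the gcd, with $(m,0)=m$. $\varphi$ is Euler's totient function. *)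

(* Defs.v *)
From HB Require Import structures.
From mathcomp Require Import all_boot all_order all_algebra all_fingroup.

Set Implicit Arguments.
Unset Strict Implicit.
Unset Printing Implicit Defensive.

Import GRing.Theory.

(* For m >= 1, C_m is the additive group 'I_m.-1.+1 of residues mod m, and its
   automorphism group (Z/mZ)^x is {unit 'Z_m}.  When m = 1, MathComp's 'Z_m is
   Z/2Z, hence 'Z_m is not used as the carrier of C_m; but {unit 'Z_1} is the
   trivial group, so {unit 'Z_m} is the right group for every m >= 1. *)
Notation cyc m := 'I_m.-1.+1.

Definition cyc_act (m : nat) (u : {unit 'Z_m}) (i : cyc m) : cyc m :=
  inZp (val u * i)%N.

Lemma cyc_act1 m (i : cyc m) : cyc_act 1%g i = i.
Proof.
by case: m i => [|[|m]] i; apply: val_inj; rewrite ?[i]ord1 //= mul1n modn_small.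
Qed.

Lemma cyc_actM m (u v : {unit 'Z_m}) (i : cyc m) :
  cyc_act (u * v)%g i = cyc_act u (cyc_act v i).
Proof.
case: m u v i => [|[|m]] u v i; try by rewrite [LHS]ord1 [RHS]ord1.
by apply: val_inj; rewrite /= modnMml modnMmr mulnA.
Qed.

Lemma cyc_actD m (u : {unit 'Z_m}) : {morph @cyc_act m u : i j / (i + j)%R}.
Proof.
by move=> i j; apply: val_inj; rewrite /= modnMmr mulnDr modnDm.
Qed.

Section SemidirectProduct.

Variables (m : nat) (hT : finGroupType).

(* Library external semidirect products (sdprod_by) are built from right
   actions and put the acting factor first, with the product
   (a, x) (b, y) = (a b, (x acted on by b) y); the product below is instead
   (i, h1) (j, h2) = (i + alpha(h1) j, h1 h2). *)
Record semidirect (alpha : {morphism [set: hT] >-> {unit 'Z_m}}) : predArgType :=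
  Semidirect { sd_val : cyc m * hT }.

Variable alpha : {morphism [set: hT] >-> {unit 'Z_m}}.
Notation sdT := (semidirect alpha).

HB.instance Definition _ := [isNew for @sd_val alpha].
#[hnf] HB.instance Definition _ := [Finite of sdT by <:].

Definition sd_mul (g1 g2 : sdT) : sdT :=
  let: (i, h1) := sd_val g1 in
  let: (j, h2) := sd_val g2 in
  Semidirect alpha ((i + cyc_act (alpha h1) j)%R, (h1 * h2)%g).

Definition sd_one : sdT := Semidirect alpha (0%R, 1%g).

Definition sd_inv (g : sdT) : sdT :=
  let: (i, h) := sd_val g in
  Semidirect alpha ((- cyc_act (alpha h^-1%g) i)%R, h^-1%g).

Lemma sd_mulA : associative sd_mul.
Proof.
move=> [[i h1]] [[j h2]] [[k h3]]; rewrite /sd_mul /=.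
by rewrite cyc_actD morphM ?inE // cyc_actM addrA mulgA.
Qed.

Lemma sd_mul1 : left_id sd_one sd_mul.
Proof.
by move=> [[i h]]; rewrite /sd_mul /= morph1 cyc_act1 add0r mul1g.
Qed.

Lemma sd_mulV : left_inverse sd_one sd_inv sd_mul.
Proof. by move=> [[i h]]; rewrite /sd_mul /= addNr mulVg. Qed.

HB.instance Definition _ := Finite_isGroup.Build sdT sd_mulA sd_mul1 sd_mulV.

(* For m = 1 this lives in Z/2Z rather than Z/1Z, but the gcd of power_sum h
   and 1 is 1 in any case. *)
Definition power_sum (h : hT) : 'Z_m :=
  (\sum_(t < #[h]%g) val (alpha h) ^+ t)%R.

End SemidirectProduct.

Definition num_of_order (gT : finGroupType) (d : nat) : nat :=
  #|[set g : gT | #[g]%g == d]|.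

(* Main.v *)
Require Import Defs.
From mathcomp Require Import all_boot all_order all_algebra all_fingroup.
From mathcomp Require Import cyclic.

(** For [g = (i, h)] with [n = ord h], [g ^+ n = (i S_h, 1)], so that
    [ord g = n * ord (i S_h)] with [n %| #|H|] and [ord (i S_h) %| m]; by
    coprimality [ord g = d1 * d2] means [n = d2] and [ord (i S_h) = d1].  For
    fixed [h], [i |-> i S_h] is an endomorphism of [C_m] with kernel of order
    [(m, S_h)] and image the subgroup of order [m / (m, S_h)], which has
    [phi d1] elements of order [d1] if [d1] divides its order and none
    otherwise. *)

Import GRing.Theory.

Set Implicit Arguments.
Unset Strict Implicit.
Unset Printing Implicit Defensive.

Section Cyclic.
Local Open Scope group_scope.

(** A cyclic group has exactly one subgroup of order [d], here generated by [a ^+ (#[a] %/ d)], so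
    the elements of order [d] are its generators. *)
Lemma card_order_cyclic (gT : finGroupType) (G : {group gT}) (d : nat) :
  cyclic G -> d %| #|G| -> #|[set x in G | #[x] == d]| = totient d.
Proof.
case/cyclicP=> a defG d_dvd.
have d_dvd_a : d %| #[a] by rewrite orderE -defG.
have od : #[a ^+ (#[a] %/ d)] = d.
  have [e def_a] := dvdnP d_dvd_a; have := order_gt0 a.
  rewrite def_a muln_gt0 => /andP[e_gt0 d_gt0].
  by rewrite mulnK // orderXdiv def_a ?dvdn_mulr // mulKn.
rewrite -{2}od totient_gen; apply: eq_card => x; rewrite !inE /generator.
have sKG : <[a ^+ (#[a] %/ d)]> \subset G by rewrite defG cycleX.
have cG : cyclic G by rewrite defG cycle_cyclic.
apply/andP/idP=> [[xG /eqP ox] | /eqP eqK].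
  by rewrite (eq_subG_cyclic cG) -?orderE ?od ?ox // cycle_subG.
by split; [rewrite -cycle_subG -eqK | rewrite orderE -eqK -orderE od].
Qed.

(** The solutions form a coset of the kernel of [x |-> x ^+ s]. Its image has order [#[a] %/ gcdn
    #[a] s], so Lagrange gives the order of the kernel. *)
Lemma card_root_cycle (gT : finGroupType) (a y : gT) (s : nat) :
  y \in <[a ^+ s]> -> #|[set x in <[a]> | x ^+ s == y]| = gcdn #[a] s.
Proof.
pose f := cyclem_morphism a s; have im_f : f @* <[a]> = <[a ^+ s]>.
  by rewrite morphim_cycle ?cycle_id.
rewrite -im_f => /morphimP[x0 _ x0a def_y].
transitivity #|'ker f :* x0|.
  apply: eq_card => x; rewrite inE; apply/andP/idP=> [[xa /eqP xy]|x_in].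
    by apply/(rcoset_kerP _ xa x0a); rewrite /= /cyclem xy def_y.
  have xa : x \in <[a]>.
    case/rcosetP: x_in => k /(subsetP (normal_sub (ker_normal f))) ka ->.
    by rewrite groupM.
  by split=> //; rewrite def_y -(rcoset_kerP _ xa x0a x_in).
have := card_morphim f <[a]>; rewrite im_f setIid -orderE orderXgcd => idx.
have := Lagrange (normal_sub (ker_normal f)); rewrite -idx -orderE card_rcoset => kerE.
have gt0 : 0 < #[a] %/ gcdn #[a] s.
  by rewrite -orderXgcd order_gt0.
by apply/eqP; rewrite -(eqn_pmul2r gt0) kerE mulnC divnK ?dvdn_gcdl.
Qed.

Lemma card_orderX_cycle (gT : finGroupType) (a : gT) (s d : nat) :
  #|[set x in <[a]> | #[x ^+ s] == d]| =
    (totient d * (gcdn #[a] s * (d %| #[a] %/ gcdn #[a] s)))%N.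
Proof.
have im x : x \in <[a]> -> x ^+ s \in <[a ^+ s]>.
  by case/cycleP=> k ->; rewrite -expgM mulnC expgM mem_cycle.
rewrite -orderXgcd; case: (boolP (d %| _)) => [d_dvd | nd_dvd]; last first.
  rewrite !muln0; apply: eq_card0 => x; rewrite !inE.
  apply: contraNF nd_dvd => /andP[/im /order_dvdG]; rewrite -orderE.
  by move=> ? /eqP <-.
rewrite muln1 -(card_order_cyclic (cycle_cyclic (a ^+ s))) //.
rewrite -!sum1_card.
(* Split by the value [y] of [x ^+ s]: each [y] of order [d] in the image has a fibre of [gcdn #[a]
   s] elements. *)
rewrite (partition_big (fun x => x ^+ s) [in [set y in <[a ^+ s]> | #[y] == d]]) /=.
  rewrite big_distrl; apply: eq_bigr => y /=.
  rewrite mul1n inE => /andP[ya /eqP oy].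
  rewrite -(card_root_cycle ya) sum1_card; apply: eq_card => x.
  rewrite [in LHS]unfold_in !inE; case: (x ^+ s =P y) => [->|]; last by rewrite !andbF.
  by rewrite oy eqxx !andbT.
by move=> x; rewrite !inE => /andP[/im -> ->].
Qed.
End Cyclic.

(** This drives the recursion S_(k+1) = 1 + alpha(h) S_k for the exponents in [sd_expg]. Reducing
    exponents modulo [m] is harmless in C_m; for [m <= 1], where ['Z_m] is Z/2Z, the group [cyc m]
    is trivial. *)
Lemma cyc_actX (m : nat) (u : {unit 'Z_m}) (i : cyc m) (s : 'Z_m) :
  (i + cyc_act u (i ^+ s)%g)%R = (i ^+ (1 + val u * s : 'Z_m)%R)%g.
Proof.
case: m u i s => [|[|n]] u i s; try by rewrite [LHS]ord1 [RHS]ord1.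
apply: val_inj; rewrite !Zp_expg /Zp_trunc /= modnMmr modnDmr.
by rewrite modnDm modnMmr mulnDr muln1 mulnCA.
Qed.

Section Semidirect.
Local Open Scope group_scope.
Variables (m : nat) (hT : finGroupType).
Variable alpha : {morphism [set: hT] >-> {unit 'Z_m}}.
Notation sd i h := (Semidirect alpha (i, h)).

Lemma sd_expg (i : cyc m) (h : hT) (k : nat) :
  sd i h ^+ k = sd (i ^+ (\sum_(t < k) val (alpha h) ^+ t : 'Z_m)%R) (h ^+ k).
Proof.
elim: k => [|k IHk]; first by rewrite big_ord0 !expg0.
rewrite expgS IHk [LHS]/(sd_mul _ _) /sd_mul /= -expgS; congr (sd _ _).
rewrite cyc_actX big_ord_recl expr0 big_distrr.
by under [in RHS]eq_bigr => t _ do rewrite lift0 exprS.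
Qed.

Lemma order_sd (i : cyc m) (h : hT) :
  #[sd i h] = (#[h] * #[i ^+ power_sum alpha h])%N.
Proof.
have pow_h k : sd i h ^+ k = 1 -> #[h] %| k.
  by rewrite sd_expg order_dvdn => -[_ ->].
have h_dvd : #[h] %| #[sd i h] by rewrite pow_h ?expg_order.
have pow1 (j : cyc m) k : sd j 1 ^+ k = sd (j ^+ k) 1.
  elim: k => // k IHk; rewrite !expgS IHk [LHS]/(sd_mul _ _) /sd_mul /=.
  by rewrite morph1 cyc_act1 mulg1.
have order1 (j : cyc m) : #[sd j 1] = #[j].
  apply/eqP; rewrite eqn_dvd !order_dvdn pow1 expg_order eqxx /=.
  by have := expg_order (sd j 1); rewrite pow1 => -[->].
(* The element (i S_h, 1) is the [#[h]]-th power of (i, h), and [#[h]] divides the order of (i, h),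
   so its order is the quotient. *)
rewrite -order1 -[in RHS](expg_order h) -sd_expg orderXdiv // mulnC divnK //.
Qed.
End Semidirect.

Lemma muln_gcd_coprime d m n :
  coprime m n -> d %| m * n -> gcdn d m * gcdn d n = d.
Proof.
move=> co d_dvd; apply/eqP; rewrite eqn_dvd.
rewrite Gauss_dvd ?dvdn_gcdl /=; last first.
  apply: coprime_dvdl (dvdn_gcdr d m) _.
  by apply: coprime_dvdr (dvdn_gcdr d n) co.
(* Expanded, the product is the gcd of d d, m d, d n and m n, all multiples of [d]. *)
rewrite muln_gcdr !muln_gcdl !dvdn_gcd d_dvd.
by rewrite (dvdn_mulr _ (dvdnn d)) (dvdn_mulr _ (dvdnn d)) (dvdn_mull _ (dvdnn d)).
Qed.

(** The product determines its factors: p1 = gcd(m, p1 p2) because p2 is coprime to m, and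
    symmetrically for p2. *)
Lemma coprime_divisors_unique m n p1 p2 q1 q2 :
  coprime m n -> p1 %| m -> p2 %| n -> q1 %| m -> q2 %| n ->
  p1 * p2 = q1 * q2 -> p1 = q1 /\ p2 = q2.
Proof.
have gcd1 k a b : coprime k b -> a %| k -> gcdn k (a * b) = a.
  by move=> co /gcdn_idPr {2}<-; rewrite Gauss_gcdl.
move=> co p1m p2n q1m q2n e.
have co2 k : k %| n -> coprime m k by move=> /coprime_dvdr; apply.
have co1 k : k %| m -> coprime n k.
  by move=> /coprime_dvdl/(_ co); rewrite coprime_sym.
split; [rewrite -(gcd1 m p1 p2) // ?e ?gcd1 // | ]; try exact: co2.
by rewrite -(gcd1 n p2 p1) 1?mulnC ?e 1?mulnC ?gcd1 //; apply: co1.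
Qed.

Theorem theorem5p2 (m : nat) (m_ge1 : 1 <= m) (hT : finGroupType)
    (co_m_H : coprime m #|hT|)
    (alpha : {morphism [set: hT] >-> {unit 'Z_m}})
    (d : nat) (d_dvd_G : d %| #|semidirect alpha|) :
  (exists! p : nat * nat, [/\ d = p.1 * p.2, p.1 %| m & p.2 %| #|hT|]) /\
  (forall d1 d2 : nat, d = d1 * d2 -> d1 %| m -> d2 %| #|hT| ->
     num_of_order (semidirect alpha) d =
       totient d1 *
       \sum_(h : hT | #[h]%g == d2)
          gcdn m (power_sum alpha h) *
          nat_of_bool (d1 %| m %/ gcdn m (power_sum alpha h))).
Proof.
have sd_bij : bijective (@sd_val m hT alpha).
  by exists (@Semidirect m hT alpha) => // -[].
split.
  have card_sd : #|semidirect alpha| = m * #|hT|.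
    by rewrite (bij_eq_card sd_bij) card_prod card_ord prednK.
  exists (gcdn d m, gcdn d #|hT|); split=> [|[q1 q2] [/= e q1m q2n]].
    split; rewrite ?dvdn_gcdr //=.
    by rewrite muln_gcd_coprime // -card_sd.
  have [] := @coprime_divisors_unique m #|hT| (gcdn d m) (gcdn d #|hT|) q1 q2;
    rewrite ?dvdn_gcdr ?muln_gcd_coprime -?card_sd //.
  by move=> -> ->.
move=> d1 d2 def_d d1m d2n.
have order_eq (i : cyc m) (h : hT) :
    (#[Semidirect alpha (i, h)]%g == d) =
    (#[h]%g == d2) && (#[i ^+ power_sum alpha h]%g == d1).
  rewrite order_sd def_d; apply/eqP/andP=> [e|[/eqP-> /eqP->]]; last exact: mulnC.
  have := @coprime_divisors_unique m #|hT| #[i ^+ power_sum alpha h]%g #[h]%g d1 d2.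
  case=> //; last by move=> -> ->.
  - by have := order_dvdG (in_setT (i ^+ power_sum alpha h)%g); rewrite cardsT card_ord prednK.
  - by have := order_dvdG (in_setT h); rewrite cardsT.
  - by rewrite mulnC.
rewrite /num_of_order -sum1_card big_distrr /=.
(* The component in H comes first, so that the condition on [i], which depends on [h], can become an
   inner sum. *)
rewrite (reindex (fun p : hT * cyc m => Semidirect alpha (p.2, p.1))) /=.
rewrite (eq_bigl (fun p : hT * cyc m =>
    (#[p.1]%g == d2) && (#[p.2 ^+ power_sum alpha p.1]%g == d1))); last first.
  by case=> h i; rewrite inE order_eq.
rewrite -(pair_big_dep (fun h => #[h]%g == d2)
    (fun h (i : cyc m) => #[i ^+ power_sum alpha h]%g == d1) (fun _ _ => 1)) /=.
  apply: eq_bigr => h _; rewrite sum1_card.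
  (* C_m is generated by [Zp1], of order [m]; this counts the [i] lying over a fixed [h]. *)
  have := card_orderX_cycle (Zp1 : cyc m) (power_sum alpha h) d1.
  rewrite -Zp_cycle (_ : #[Zp1 : cyc m]%g = m) => [<-|]; last by rewrite order_Zp1 prednK.
  by apply: eq_card => i; rewrite !inE.
by exists (fun g => let: (i, h) := sd_val g in (h, i)) => [[]|[[]]].
Qed.
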